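(* If $K$ is a normal subgroup of $\Delta$ with $\Delta/K\cong L_2(q)$ for some prime power $q$, then $K$ is normal in $\Omega^+$ with $\Omega^+/K$ isomorphic to $PGL_2(q)$ or $L_2(q)\times C_2$.
   Context: $L_2(q)=SL_2(q)/\{\pm I\}$ where $q\geq4$ is a prime power; $C_2$ is the cyclic group of order $2$. $\Gamma=[3,5,3]$ is the Coxeter group $$\langle a,b,c,d\mid a^2=b^2=c^2=d^2=(ab)^3=(bc)^5=(cd)^3=(ac)^2=(ad)^2=(bd)^2=1\rangle,$$ realised as the discrete group of isometries of hyperbolic $3$-space $\mathcal H^3$ generated by the reflections $a,b,c,d$ in the faces opposite the vertices $A,B,C,D$ of a tetrahedron $ABCD$ with dihedral angles $\pi/2$ along $AC$, $BC$, $BD$, angles $\pi/3$ along $AB$, $CD$, and angle $\pi/5$ along $AD$. $\Delta=\Gamma^+=[3,5,3]^+$ is its even (orientation-preserving) subgroup of index $2$, with presentation $$\langle\alpha,\beta,\gamma\mid\alpha^3=\beta^5=\gamma^3=(\alpha\beta)^2=(\beta\gamma)^2=(\alpha\beta\gamma)^2=1\rangle,\quad \alpha=ab,\ \beta=bc,\ \gamma=cd.$$ $\Omega$ is the normaliser of $\Gamma$ in $\mathrm{Iso}\,\mathcal H^3$; it is the semidirect product $\Gamma\rtimes\langle r\rangle$, where $r$ is a half-turn ($r^2=1$) and conjugation by $r$ transposes $a$ and $d$ and transposes $b$ and $c$. $\Omega^+$ is the orientation-preserving subgroup of $\Omega$; it is the semidirect product $\Delta\rtimes\langle r\rangle$,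 where conjugation by $r$ transposes $\alpha$ and $\gamma^{-1}$ and inverts $\beta$. *)

(* Defs.v *)
From HB Require Import structures.
From mathcomp Require Import all_boot all_order all_algebra all_fingroup.
From mathcomp Require Import generic_quotient.
From mathcomp Require Import boolp classical_sets functions.

Set Implicit Arguments.
Unset Strict Implicit.
Unset Printing Implicit Defensive.

Import GRing.Theory GroupScope.

Section Presentation.
Variable X : choiceType.

(* (x, false) is the generator x and (x, true) its inverse. *)
Definition word := seq (X * bool).

Definition word_inv (w : word) : word := rev [seq (l.1, ~~ l.2) | l <- w].

Definition word_pow (w : word) (n : nat) : word := flatten (nseq n w).

Variable R : seq word.

Inductive word_eqv : word -> word -> Prop :=
| word_eqv_refl u : word_eqv u u
| word_eqv_sym u v : word_eqv u v -> word_eqv v u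
| word_eqv_trans u v w : word_eqv u v -> word_eqv v w -> word_eqv u w
| word_eqv_free u v x e :
    word_eqv (u ++ [:: (x, e); (x, ~~ e)] ++ v) (u ++ v)
| word_eqv_rel u v w : w \in R -> word_eqv (u ++ w ++ v) (u ++ v).

Lemma word_eqv_ctx p s u v :
  word_eqv u v -> word_eqv (p ++ u ++ s) (p ++ v ++ s).
Proof.
elim=> {u v}.
- by move=> u; exact: word_eqv_refl.
- by move=> u v _; exact: word_eqv_sym.
- by move=> u v w _ IH1 _ IH2; exact: word_eqv_trans IH1 IH2.
- move=> u v x e; have := word_eqv_free (p ++ u) (v ++ s) x e.
  by rewrite -!catA.
- move=> u v w wR; have := word_eqv_rel (p ++ u) (v ++ s) wR.
  by rewrite -!catA.
Qed.

Lemma word_eqv_cat u u' v v' :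
  word_eqv u u' -> word_eqv v v' -> word_eqv (u ++ v) (u' ++ v').
Proof.
move=> uu' vv'; apply: (@word_eqv_trans _ (u' ++ v)).
  exact: (word_eqv_ctx [::] v uu').
by have := word_eqv_ctx u' [::] vv'; rewrite !cats0.
Qed.

Lemma word_invV w : word_eqv (word_inv w ++ w) [::].
Proof.
elim: w => [|[x e] w IH]; first exact: word_eqv_refl.
rewrite /word_inv /= rev_cons cat_rcons; apply: word_eqv_trans IH.
by have := word_eqv_free (word_inv w) w x (~~ e); rewrite negbK.
Qed.

Lemma word_invK : involutive word_inv.
Proof.
move=> w; rewrite /word_inv map_rev revK -map_comp -[RHS]map_id.
by apply: eq_map => -[x e] /=; rewrite negbK.
Qed.

Definition word_eqb (u v : word) : bool := `[< word_eqv u v >].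

Lemma word_eqb_equiv : equiv_class_of word_eqb.
Proof.
split.
- by move=> u; apply/asboolP; exact: word_eqv_refl.
- by move=> u v; apply/asboolP/asboolP; exact: word_eqv_sym.
- move=> v u w /asboolP uv /asboolP vw; apply/asboolP.
  exact: word_eqv_trans uv vw.
Qed.

Canonical word_eqb_equivrel := EquivRelPack word_eqb_equiv.

Definition presented := {eq_quot word_eqb}%qT.
HB.instance Definition _ := Choice.on presented.
HB.instance Definition _ := EqQuotient.on presented.

Definition wclass (w : word) : presented := (\pi_presented w)%qT.

Lemma wclassP u v : wclass u = wclass v <-> word_eqv u v.
Proof.
split; first by move/eqmodP/asboolP.
by move=> uv; apply/eqmodP/asboolP.
Qed.

Lemma wclassK (x : presented) : wclass (repr x) = x.
Proof. exact: reprK. Qed.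

Lemma repr_wclass w : word_eqv (repr (wclass w)) w.
Proof. by apply/wclassP; rewrite wclassK. Qed.

Definition presented_mul (x y : presented) := wclass (repr x ++ repr y).
Definition presented_inv (x : presented) := wclass (word_inv (repr x)).

Lemma presented_mulE u v :
  presented_mul (wclass u) (wclass v) = wclass (u ++ v).
Proof. by apply/wclassP/word_eqv_cat; exact: repr_wclass. Qed.

Lemma presented_mulA : associative presented_mul.
Proof.
move=> x y z; rewrite -[x]wclassK -[y]wclassK -[z]wclassK.
by rewrite !presented_mulE catA.
Qed.

Lemma presented_mul1 : left_id (wclass [::]) presented_mul.
Proof. by move=> x; rewrite -[x]wclassK presented_mulE. Qed.

Lemma presented_mulr1 : right_id (wclass [::]) presented_mul.
Proof. by move=> x; rewrite -[x]wclassK presented_mulE cats0. Qed.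

Lemma presented_mulV :
  left_inverse (wclass [::]) presented_inv presented_mul.
Proof.
move=> x; rewrite -{2}[x]wclassK presented_mulE.
by apply/wclassP; exact: word_invV.
Qed.

Lemma presented_mulrV :
  right_inverse (wclass [::]) presented_inv presented_mul.
Proof.
move=> x; rewrite -{1}[x]wclassK presented_mulE.
apply/wclassP; rewrite -{1}[repr x]word_invK; exact: word_invV.
Qed.

HB.instance Definition _ := isGroup.Build presented presented_mulA
  presented_mul1 presented_mulr1 presented_mulV presented_mulrV.

Lemma wclassM u v : wclass (u ++ v) = wclass u * wclass v.
Proof. by rewrite -presented_mulE. Qed.

Lemma wclass_pow w n : wclass (word_pow w n) = wclass w ^+ n.
Proof. by elim: n => // n IH; rewrite expgS -IH -wclassM. Qed.

Lemma wclass_rel w : w \in R -> wclass w = 1.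
Proof.
move=> wR; apply/wclassP; have := word_eqv_rel [::] [::] wR.
by rewrite /= cats0.
Qed.

End Presentation.

(* Semidirect product of N by a group <r> of order 2, with r acting on N as the
   involutive automorphism s: the pair (x, e) stands for x * r ^+ e, and
   r * x * r^-1 = s x. *)

Record involAut (N : groupType) := InvolAut {
  iaut :> N -> N;
  iautM : {morph iaut : x y / x * y};
  iautK : involutive iaut }.

Section SemidirectC2.
Variable N : groupType.

Definition sdprodC2 (s : involAut N) : Type := (N * bool)%type.

Variable s : involAut N.

HB.instance Definition _ := Choice.copy (sdprodC2 s) (N * bool)%type.

Definition twist (e : bool) (x : N) : N := if e then s x else x.

Lemma twistM e : {morph twist e : x y / x * y}.
Proof. by case: e => // x y; exact: iautM. Qed.

Lemma twistD e f x : twist (e (+) f) x = twist e (twist f x).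
Proof. by case: e f => [] [] //=; rewrite iautK. Qed.

Lemma twist1 e : twist e 1 = 1.
Proof. by apply: (mulgI (twist e 1)); rewrite -twistM !mulg1. Qed.

Definition sdprodC2_mul (u v : sdprodC2 s) : sdprodC2 s :=
  (u.1 * twist u.2 v.1, u.2 (+) v.2).
Definition sdprodC2_one : sdprodC2 s := (1, false).
Definition sdprodC2_inv (u : sdprodC2 s) : sdprodC2 s := (twist u.2 u.1^-1, u.2).

Lemma sdprodC2_mulA : associative sdprodC2_mul.
Proof.
move=> [x e] [y f] [z g]; rewrite /sdprodC2_mul /=.
by rewrite twistM twistD !mulgA addbA.
Qed.

Lemma sdprodC2_mul1 : left_id sdprodC2_one sdprodC2_mul.
Proof. by move=> [x e]; rewrite /sdprodC2_mul /= mul1g. Qed.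

Lemma sdprodC2_mulr1 : right_id sdprodC2_one sdprodC2_mul.
Proof. by move=> [x e]; rewrite /sdprodC2_mul /= twist1 mulg1 addbF. Qed.

Lemma sdprodC2_mulV : left_inverse sdprodC2_one sdprodC2_inv sdprodC2_mul.
Proof.
by move=> [x e]; rewrite /sdprodC2_mul /= -twistM mulVg twist1 addbb.
Qed.

Lemma sdprodC2_mulrV : right_inverse sdprodC2_one sdprodC2_inv sdprodC2_mul.
Proof.
by move=> [x e]; rewrite /sdprodC2_mul /= -twistD addbb /= mulgV.
Qed.

HB.instance Definition _ := isGroup.Build (sdprodC2 s) sdprodC2_mulA
  sdprodC2_mul1 sdprodC2_mulr1 sdprodC2_mulV sdprodC2_mulrV.

End SemidirectC2.

(* The generators a, b, c, d of [3,5,3] are numbered 0, 1, 2, 3. *)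

Definition letter (i : nat) : word 'I_4 := [:: (inord i, false)].

Definition relators353 : seq (word 'I_4) :=
  let a := letter 0 in let b := letter 1 in
  let c := letter 2 in let d := letter 3 in
  [:: word_pow a 2; word_pow b 2; word_pow c 2; word_pow d 2;
      word_pow (a ++ b) 3; word_pow (b ++ c) 5; word_pow (c ++ d) 3;
      word_pow (a ++ c) 2; word_pow (a ++ d) 2; word_pow (b ++ d) 2].

Definition Gamma353 := presented relators353.

(* The half-turn r transposes a, d and b, c, i.e. it acts on the numbering by
   rev_ord. *)

Definition flip_word (w : word 'I_4) : word 'I_4 :=
  [seq (rev_ord l.1, l.2) | l <- w].

Definition flip (x : Gamma353) : Gamma353 :=
  wclass relators353 (flip_word (repr x)).

Lemma flip_wordK : involutive flip_word.
Proof.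
move=> w; rewrite /flip_word -map_comp -[RHS]map_id.
by apply: eq_map => -[i e] /=; rewrite rev_ordK.
Qed.

Lemma flip_word_cat u v : flip_word (u ++ v) = flip_word u ++ flip_word v.
Proof. exact: map_cat. Qed.

Lemma flip_word_pow w n : flip_word (word_pow w n) = word_pow (flip_word w) n.
Proof. by elim: n => // n IH; rewrite [LHS]flip_word_cat IH. Qed.

Lemma flip_letter i : i < 4 -> flip_word (letter i) = letter (3 - i).
Proof.
move=> i4; rewrite /flip_word /letter /=; congr [:: (_, _)].
by apply: val_inj; rewrite /= !inordK // ltnS leq_subr.
Qed.

Lemma flip_rel w : w \in relators353 -> wclass relators353 (flip_word w) = 1.
Proof.
pose g i := wclass relators353 (letter i).
have rel v n : word_pow v n \in relators353 ->
    wclass relators353 v ^+ n = 1.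
  by move=> vR; rewrite -wclass_pow wclass_rel.
have sq i : i < 4 -> g i * g i = 1.
  move=> i4; rewrite -expg2; apply: rel.
  by case: i i4 => [|[|[|[|]]]] // _; rewrite !inE eqxx ?orbT.
have gV i : i < 4 -> (g i)^-1 = g i.
  by move=> i4; apply: (mulgI (g i)); rewrite mulgV sq.
have com i j n : i < 4 -> j < 4 ->
    word_pow (letter i ++ letter j) n \in relators353 ->
    (g j * g i) ^+ n = 1.
  move=> i4 j4 /rel; rewrite wclassM -/(g i) -/(g j) => gij.
  by rewrite -[g j]gV // -[g i]gV // -invMg expVgn gij invg1.
rewrite !inE => w_rel.
by move: w_rel; do 9?[case/orP]; move=> /eqP->;
  rewrite flip_word_pow ?flip_word_cat !flip_letter //;
  rewrite wclass_pow ?wclassM; (try by rewrite expg2 sq);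
  apply: com => //; rewrite !inE eqxx ?orbT.
Qed.

Lemma flip_word_eqv u v : word_eqv relators353 u v ->
  wclass relators353 (flip_word u) = wclass relators353 (flip_word v).
Proof.
elim=> {u v} //.
- by move=> u v w _ -> _ ->.
- move=> u v i e; rewrite !flip_word_cat; apply/wclassP.
  exact: word_eqv_free.
- move=> u v w wR; rewrite !flip_word_cat !wclassM.
  by rewrite (flip_rel wR) mul1g.
Qed.

Lemma flip_wclass w :
  flip (wclass relators353 w) = wclass relators353 (flip_word w).
Proof. exact/flip_word_eqv/repr_wclass. Qed.

Lemma flipM : {morph flip : x y / x * y}.
Proof.
move=> x y; rewrite -[x]wclassK -[y]wclassK -wclassM !flip_wclass.
by rewrite flip_word_cat wclassM.
Qed.

Lemma flipK : involutive flip.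
Proof. by move=> x; rewrite -[x]wclassK !flip_wclass flip_wordK. Qed.

Definition flip_aut : involAut Gamma353 := InvolAut flipM flipK.

Definition Omega353 := sdprodC2 flip_aut.

Definition refl (i : 'I_4) : Omega353 :=
  (wclass relators353 [:: (i, false)], false).

Definition half_turn : Omega353 := (1, true).

Lemma half_turn_sq : half_turn ^+ 2 = 1.
Proof.
by rewrite expg2 /half_turn; congr (_, _); rewrite mul1g (twist1 flip_aut true).
Qed.

Lemma refl_half_turn i : refl i ^ half_turn = refl (rev_ord i).
Proof.
rewrite /conjg; congr (_, _).
rewrite /= invg1 mulg1 flip_wclass; have /= -> := twist1 flip_aut true.
exact: mul1g.
Qed.

(* The generators a, b, c, d are reflections and r is a half-turn, so the
   orientation is given by the parity of the number of reflections. *)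
Definition reverses_orientation (x : Omega353) : bool := odd (size (repr x.1)).

Lemma odd_size_word_eqv u v :
  word_eqv relators353 u v -> odd (size u) = odd (size v).
Proof.
elim=> {u v} //.
- by move=> u v w _ -> _ ->.
- by move=> u v i e; rewrite !size_cat /= !addnS !oddS negbK.
- move=> u v w wR; rewrite !size_cat !oddD.
  suff -> : odd (size w) = false by [].
  by move: wR; rewrite !inE; do 9?[case/orP]; move=> /eqP->.
Qed.

Lemma reverses_orientation_wclass w e :
  reverses_orientation (wclass relators353 w, e) = odd (size w).
Proof. exact/odd_size_word_eqv/repr_wclass. Qed.

Lemma reverses_orientationM :
  {morph reverses_orientation : x y / x * y >-> x (+) y}.
Proof.
move=> [x e] [y f]; rewrite /reverses_orientation /= -oddD.
have -> : twist flip_aut e y = wclass relators353 (if e then flip_word (repr y)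
                                                   else repr y).
  by case: e => //=; rewrite wclassK.
rewrite -[x in x * _]wclassK -wclassM.
rewrite (odd_size_word_eqv (repr_wclass _ _)) size_cat.
by case: e => //; rewrite size_map.
Qed.

Lemma reverses_orientation_refl i : reverses_orientation (refl i).
Proof. by rewrite reverses_orientation_wclass. Qed.

Lemma reverses_orientation_half_turn : ~~ reverses_orientation half_turn.
Proof. by rewrite reverses_orientation_wclass. Qed.

Definition Gamma : set Omega353 := [set x | x.2 = false]%classic.

Definition Omega_plus : set Omega353 := [set x | ~~ reverses_orientation x]%classic.

Definition Delta : set Omega353 := (Gamma `&` Omega_plus)%classic.

Section Subgroups.
Variable G : groupType.
Implicit Types (H K A B : set G).

Definition is_subgroup H : Prop := H 1 /\ forall x y, H x -> H y -> H (x * y^-1).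

Definition normal_in K H : Prop :=
  [/\ is_subgroup K, (K `<=` H)%classic &
      forall x y, H x -> K y -> K (y ^ x)].

Definition mulset A B : set G :=
  [set z | exists2 x, A x & exists2 y, B y & z = x * y]%classic.

Definition lcoset_set x K : set G := [set x * y | y in K]%classic.

Definition quotient_set H K : set (set G) := [set lcoset_set x K | x in H]%classic.

(* Meaningful when K is normal in H: H / K is isomorphic to L. *)
Definition quotient_iso H K (gT : finGroupType) (L : {group gT}) : Prop :=
  exists phi : set G -> gT,
    set_bij (quotient_set H K) [set y | y \in L]%classic phi /\
    forall A B, quotient_set H K A -> quotient_set H K B ->
      phi (mulset A B) = phi A * phi B.

End Subgroups.

Section LinearGroups.
Variable F : finFieldType.

Definition SL2 : {set {'GL_2[F]}} := [set u | (\det (GLval u) == 1)%R].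

Lemma SL2_group_set : group_set SL2.
Proof.
apply/group_setP; split=> [|u v]; rewrite !inE ?GL_1E ?det1 // GL_MxE.
by rewrite det_mulmx => /eqP-> /eqP->; rewrite mulr1.
Qed.
Canonical SL2_group := Group SL2_group_set.

Definition pm1 : {set {'GL_2[F]}} :=
  [set u | (GLval u == 1%:M)%R || (GLval u == (-1)%:M)%R].

Lemma pm1_group_set : group_set pm1.
Proof.
apply/group_setP; split=> [|u v]; rewrite !inE ?GL_1E ?eqxx // GL_MxE.
by move=> /orP[]/eqP-> /orP[]/eqP->; rewrite -scalar_mxM ?mulrNN ?mulr1 ?mul1r
  eqxx ?orbT.
Qed.
Canonical pm1_group := Group pm1_group_set.

Definition scalars : {set {'GL_2[F]}} := [set u | is_scalar_mx (GLval u)].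

Lemma scalars_group_set : group_set scalars.
Proof.
apply/group_setP; split=> [|u v]; rewrite !inE ?GL_1E ?scalar_mx_is_scalar //.
rewrite GL_MxE => /is_scalar_mxP[x ->] /is_scalar_mxP[y ->].
by rewrite -scalar_mxM scalar_mx_is_scalar.
Qed.
Canonical scalars_group := Group scalars_group_set.

Definition L2 : {group coset_of pm1} := (SL2 / pm1)%G.

Definition PGL2 : {group coset_of scalars} := ('GL_2[F] / scalars)%G.

Definition L2xC2 : {group coset_of pm1 * 'Z_2} := setX_group L2 [set: 'Z_2]%G.

End LinearGroups.

(* Main.v *)
Require Import Defs.
From mathcomp Require Import all_boot all_order all_algebra all_fingroup.
From mathcomp Require Import boolp classical_sets.
From mathcomp Require Import cyclic ring.

(** Three products of commuting reflections, p = ac, q = bd and t = ad,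
    generate Delta (one has tq = ab, qtp = bc and pt = cd), and conjugation by
    the half-turn r exchanges p and q and fixes t ([conjr_ac], [conjr_bd],
    [conjr_ad], [Delta_ind]).  So the theorem asks for an element of PGL_2(q)
    that exchanges the images of p and q and commutes with the image of t.

    In an image L_2(q) of Delta the elements p, q, t are involutions, so they
    lift to matrices P, Q, T of SL_2(q) with trace 0 and square -1.  As pt = cd
    and tq = ab have order 3, the traces of PT and TQ are 1 or -1, and after
    replacing P by -P, if need be, they are equal.  The wanted element is then
    simply N = P - Q.  Indeed P^2 = Q^2 gives NP = -QN.  Two matrices of trace 0
    have a scalar anticommutator AB + BA = tr(AB), so that equality of the two
    traces gives NT = -TN, and that N^2 = -2 - tr(PQ) is scalar.  If N is
    singular, then N^2 = 0, whence PN = QN and NP = NQ, so that N commutes up to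
    sign with P, Q and T, hence with every element of SL_2(q); comparing with
    transvections gives N = 0.  But P = Q is impossible, since then bc = qtp
    would be a conjugate of the involution t, while its fifth power is trivial
    ([exists_intertwiner]).  The argument is the same in every characteristic.

    A homomorphism on Delta extends to Omega^+ as soon as r is sent to an
    involution that acts on the images of p, q, t as r does on p, q, t
    ([half_turn_ext_morphic]).  If det N is a square, N is a scalar multiple of
    some S in SL_2(q); sending r to (S, 1) gives an epimorphism onto
    L_2(q) x C_2 with kernel K.  If det N is not a square, sending r to the
    class of N gives one onto PGL_2(q): it is injective modulo K because N is
    not a scalar multiple of an element of SL_2(q), and surjective because a
    quotient of two nonsquares of a finite field is a square. *)

Set Implicit Arguments.
Unset Strict Implicit.
Unset Printing Implicit Defensive.

Import GRing.Theory GroupScope.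

(** * Quotients and epimorphisms *)

Section FirstIsomorphism.
Variables (G : groupType) (H K : set G) (gT : finGroupType).
Implicit Types (f : G -> gT) (L : {group gT}).

Definition morphic_on f := forall x y, H x -> H y -> f (x * y) = f x * f y.

Definition epi_with_kernel f L :=
  [/\ morphic_on f, forall x, H x -> f x \in L,
      forall y, y \in L -> exists2 x, H x & f x = y &
      forall x, K x <-> H x /\ f x = 1].

Hypothesis sgH : is_subgroup H.

Lemma subgroup1 : H 1. Proof. by case: sgH. Qed.

Lemma subgroupV x : H x -> H x^-1.
Proof. by case: sgH => H1 HV /(HV 1 x H1); rewrite mul1g. Qed.

Lemma subgroupM x y : H x -> H y -> H (x * y).
Proof. by case: sgH => _ HV Hx /subgroupV/(HV _ _ Hx); rewrite invgK. Qed.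

Lemma morphic_on1 f : morphic_on f -> f 1 = 1.
Proof.
move=> fM; apply: (mulgI (f 1)); rewrite -fM ?mulg1 //; exact: subgroup1.
Qed.

Lemma morphic_onV f x : morphic_on f -> H x -> f x^-1 = (f x)^-1.
Proof.
move=> fM Hx; apply: (mulgI (f x)).
by rewrite -fM ?mulgV ?morphic_on1 //; exact: subgroupV.
Qed.

(** The first isomorphism theorem. *)
Lemma epi_quotient_iso f L : epi_with_kernel f L ->
  normal_in K H /\ quotient_iso H K L.
Proof.
case=> fM fL fonto Kf.
have KH x : K x -> H x by case/Kf.
have fV x : H x -> f x^-1 = (f x)^-1 by exact: morphic_onV.
have K1 : K 1 by apply/Kf; rewrite morphic_on1 //; split=> //; exact: subgroup1.
split.
  split=> //.
  - split=> // x y /Kf[Hx fx] /Kf[Hy fy]; apply/Kf.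
    have HyV := subgroupV Hy.
    by rewrite fM // fV // fx fy mul1g invg1; split=> //; exact: subgroupM.
  - move=> x y Hx /Kf[Hy fy]; have HxV := subgroupV Hx.
    have Hyx := subgroupM Hy Hx; apply/Kf; rewrite /conjg !fM // fV // fy mul1g.
    by rewrite mulVg; split=> //; exact: subgroupM.
(* A map on cosets: take f at any member; the default 1 only matters for the
   empty set, which is not a coset. *)
pose phi (A : set G) := f (xget 1 A).
have phiE A x c : A x -> (forall y, A y -> f y = c) -> phi A = c.
  by move=> Ax Ac; apply: Ac; apply: xgetPex; exists x.
have self x : lcoset_set x K x by exists 1 => //; rewrite mulg1.
have phi_coset x : H x -> phi (lcoset_set x K) = f x.
  move=> Hx; apply: (phiE _ x) => // _ [k /Kf[Hk fk] <-].
  by rewrite fM // fk mulg1.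
exists phi; split; first split.
- by move=> _ [x Hx <-]; rewrite /= phi_coset //; exact: fL.
- move=> _ _ /set_mem[x Hx <-] /set_mem[y Hy <-]; rewrite !phi_coset // => fxy.
  have Kxy : K (y^-1 * x).
    have HyV := subgroupV Hy; apply/Kf; rewrite fM // fV // fxy mulVg.
    by split=> //; exact: subgroupM.
  have HxV := subgroupV Hx.
  apply/seteqP; split=> _ [k /Kf[Hk fk] <-].
    exists (y^-1 * x * k); last by rewrite !mulgA mulgV mul1g.
    case/Kf: Kxy => Hyx fyx; apply/Kf; rewrite fM // fyx fk mulg1.
    by split=> //; exact: subgroupM.
  exists ((y^-1 * x)^-1 * k); last by rewrite invgM invgK !mulgA mulgV mul1g.
  case/Kf: Kxy => Hyx fyx; have HyxV := subgroupV Hyx.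
  apply/Kf; rewrite fM // fV // fyx fk mulg1 invg1.
  by split=> //; exact: subgroupM.
- move=> y /= /fonto[x Hx <-]; exists (lcoset_set x K); first by exists x.
  exact: phi_coset.
- move=> _ _ [x Hx <-] [y Hy <-]; rewrite !phi_coset //.
  apply: (phiE _ (x * y)); first by exists x => //; exists y.
  move=> _ [_ [k /Kf[Hk fk] <-] [_ [l /Kf[Hl fl] <-] ->]].
  rewrite !fM //; first by rewrite fk fl !mulg1.
  all: exact: subgroupM.
Qed.

(** The converse: an isomorphism of the quotient, composed with the projection,
    brings the question back to a map defined on elements, where generators and
    relations can be used. *)
Lemma quotient_iso_epi L : normal_in K H -> quotient_iso H K L ->
  exists f, epi_with_kernel f L.
Proof.
case=> -[K1 KV] KH Kn [phi [[phiL phi_inj phi_onto] phiM]].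
have KVV x : K x -> K x^-1 by move=> /(KV 1 x K1); rewrite mul1g.
have KM x y : K x -> K y -> K (x * y).
  by move=> Kx /KVV/(KV _ _ Kx); rewrite invgK.
have mem x : H x -> quotient_set H K (lcoset_set x K) by move=> Hx; exists x.
pose f x := phi (lcoset_set x K); exists f.
have fM : morphic_on f.
  move=> x y Hx Hy; rewrite /f -phiM; [|exact: mem|exact: mem].
  congr phi; apply/seteqP; split.
    move=> _ [k Kk <-]; exists x; first by exists 1; rewrite ?mulg1.
    by exists (y * k); [exists k | rewrite mulgA].
  move=> _ [_ [k Kk <-] [_ [l Kl <-] ->]].
  exists (k ^ y * l); first by apply: KM => //; exact: Kn.
  by rewrite /conjg !mulgA mulgK.
split=> //.
- by move=> x /mem/phiL.
- move=> y yL; have [A [x Hx <-] <-] := phi_onto y yL.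
  by exists x.
- move=> x; split=> [Kx | [Hx fx1]].
    have Hx := KH _ Kx; split=> //; rewrite -(morphic_on1 fM).
    rewrite /f; congr phi; apply/seteqP; split=> _ [k Kk <-].
      by exists (x * k); [exact: KM | rewrite mul1g].
    exists (x^-1 * k); first by apply: KM => //; exact: KVV.
    by rewrite mul1g mulgA mulgV mul1g.
  have e : lcoset_set x K = lcoset_set 1 K.
    apply: phi_inj; rewrite ?inE; [exact: mem | exact/mem/subgroup1|].
    by rewrite -/(f x) -/(f 1) fx1 morphic_on1.
  have : lcoset_set x K x by exists 1; rewrite ?mulg1.
  by rewrite e => -[k Kk <-]; rewrite mul1g.
Qed.

End FirstIsomorphism.

(** * The group Delta and the action of the half-turn *)

(** The reflections a, b, c, d, indexed by natural numbers so that the numerals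
    0, 1, 2, 3 can be used. *)
Definition mirror (i : nat) : Omega353 := refl (inord i).

Lemma omegaM (x y : Gamma353) :
  ((x, false) : Omega353) * ((y, false) : Omega353) = (x * y, false).
Proof. by []. Qed.

Lemma relator_nth k : k < 10 -> nth [::] relators353 k \in relators353.
Proof. by move=> k10; apply: mem_nth. Qed.

Lemma relator_Omega (w : word 'I_4) n : word_pow w n \in relators353 ->
  ((wclass relators353 w, false) : Omega353) ^+ n = 1.
Proof.
move=> /wclass_rel; rewrite wclass_pow => e.
suff -> : ((wclass relators353 w, false) : Omega353) ^+ n =
  (wclass relators353 w ^+ n, false) by rewrite e.
by elim: n {e} => // n IH; rewrite !expgS IH.
Qed.

Lemma mirror_sq i : i < 4 -> mirror i * mirror i = 1.
Proof.
move=> i4; rewrite -expg2; apply: relator_Omega.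
by case: i i4 => [|[|[|[|]]]] // _; rewrite !inE eqxx ?orbT.
Qed.

Lemma mirror_pair i j n : word_pow (letter i ++ letter j) n \in relators353 ->
  (mirror i * mirror j) ^+ n = 1.
Proof. by move=> /relator_Omega; rewrite wclassM. Qed.

Lemma mirrorV i : i < 4 -> (mirror i)^-1 = mirror i.
Proof. by move=> i4; apply: (mulgI (mirror i)); rewrite mulgV mirror_sq. Qed.

Lemma mirrorK i x : i < 4 -> mirror i * (mirror i * x) = x.
Proof. by move=> i4; rewrite mulgA mirror_sq // mul1g. Qed.

Lemma mirrorKr i x : i < 4 -> x * mirror i * mirror i = x.
Proof. by move=> i4; rewrite -mulgA mirror_sq // mulg1. Qed.

Lemma mirror_comm i j : i < 4 -> j < 4 ->
    word_pow (letter i ++ letter j) 2 \in relators353 ->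
  mirror i * mirror j = mirror j * mirror i.
Proof.
move=> i4 j4 /mirror_pair e; apply: (mulgI (mirror i * mirror j)).
by rewrite -expg2 e !mulgA mirrorKr // mirror_sq.
Qed.

(** Reflections in orthogonal planes commute, and their product is the half-turn
    about the common line; these three half-turns are the generators with which
    the proof works. *)
Definition turn_ac : Omega353 := mirror 0 * mirror 2.
Definition turn_bd : Omega353 := mirror 1 * mirror 3.
Definition turn_ad : Omega353 := mirror 0 * mirror 3.

(** Conjugation by the half-turn r, as r x r^-1 = flip x on Gamma. *)
Definition conjr (x : Omega353) : Omega353 := (flip x.1, x.2).

Lemma conjrM : {morph conjr : x y / x * y}.
Proof.
move=> [x e] [y f]; congr (_, _); rewrite /= flipM; congr (_ * _).
by case: e.
Qed.

Lemma conjr_mirror i : i < 4 -> conjr (mirror i) = mirror (3 - i).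
Proof. by move=> i4; congr (_, _); rewrite /= flip_wclass flip_letter. Qed.

Lemma mirror02_comm : mirror 0 * mirror 2 = mirror 2 * mirror 0.
Proof. by apply: mirror_comm => //; exact: (@relator_nth 7). Qed.
Lemma mirror13_comm : mirror 1 * mirror 3 = mirror 3 * mirror 1.
Proof. by apply: mirror_comm => //; exact: (@relator_nth 9). Qed.
Lemma mirror03_comm : mirror 0 * mirror 3 = mirror 3 * mirror 0.
Proof. by apply: mirror_comm => //; exact: (@relator_nth 8). Qed.

Lemma conjr_ac : conjr turn_ac = turn_bd.
Proof. by rewrite conjrM !conjr_mirror // -mirror13_comm. Qed.
Lemma conjr_bd : conjr turn_bd = turn_ac.
Proof. by rewrite conjrM !conjr_mirror // -mirror02_comm. Qed.
Lemma conjr_ad : conjr turn_ad = turn_ad.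
Proof. by rewrite conjrM !conjr_mirror // -mirror03_comm. Qed.

Lemma turn_ac_sq : turn_ac * turn_ac = 1.
Proof. rewrite -expg2; exact: (mirror_pair (@relator_nth 7 isT)). Qed.
Lemma turn_bd_sq : turn_bd * turn_bd = 1.
Proof. rewrite -expg2; exact: (mirror_pair (@relator_nth 9 isT)). Qed.
Lemma turn_ad_sq : turn_ad * turn_ad = 1.
Proof. rewrite -expg2; exact: (mirror_pair (@relator_nth 8 isT)). Qed.

Lemma turn_ad_bdE : turn_ad * turn_bd = mirror 0 * mirror 1.
Proof. by rewrite /turn_ad /turn_bd mirror13_comm -!mulgA mirrorK. Qed.
Lemma turn_ac_adE : turn_ac * turn_ad = mirror 2 * mirror 3.
Proof. by rewrite /turn_ac /turn_ad mirror02_comm -!mulgA mirrorK. Qed.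
Lemma turn_bd_ad_acE : turn_bd * turn_ad * turn_ac = mirror 1 * mirror 2.
Proof.
by rewrite /turn_ac /turn_bd /turn_ad mirror03_comm !mulgA mirrorKr // mirrorKr.
Qed.

Lemma turn_ad_bd_cube : (turn_ad * turn_bd) ^+ 3 = 1.
Proof. rewrite turn_ad_bdE; exact: (mirror_pair (@relator_nth 4 isT)). Qed.
Lemma turn_ac_ad_cube : (turn_ac * turn_ad) ^+ 3 = 1.
Proof. rewrite turn_ac_adE; exact: (mirror_pair (@relator_nth 6 isT)). Qed.
Lemma turn_bd_ad_ac_pow5 : (turn_bd * turn_ad * turn_ac) ^+ 5 = 1.
Proof. rewrite turn_bd_ad_acE; exact: (mirror_pair (@relator_nth 5 isT)). Qed.

Lemma is_subgroup_Omega_plus : is_subgroup Omega_plus.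
Proof.
have one : Omega_plus (1 : Omega353).
  rewrite /Omega_plus /=; have := reverses_orientationM 1 1.
  by rewrite mulg1 addbb => ->.
split=> // x y; rewrite /Omega_plus /= => Hx Hy.
have /esym := reverses_orientationM (x * y^-1) y.
rewrite -mulgA mulVg mulg1 (negbTE Hx) (negbTE Hy) => e.
by move: e; case: (reverses_orientation _).
Qed.

Lemma is_subgroup_Delta : is_subgroup Delta.
Proof.
case: is_subgroup_Omega_plus => O1 OV; split=> // x y [Gx Ox] [Gy Oy].
by split; [rewrite /Gamma /= Gx Gy | exact: OV].
Qed.

(** A letter and its formal inverse name the same element, the reflections being
    involutions. *)
Lemma mirror_letter (l : 'I_4 * bool) :
  ((wclass relators353 [:: l], false) : Omega353) = mirror l.1.
Proof.
case: l => i e; rewrite /mirror /letter inord_val; congr (_, _) => /=.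
case: e => //; apply: (mulgI (wclass relators353 [:: (i, false)])).
rewrite -wclassM; have := mirror_sq (ltn_ord i).
rewrite /mirror /letter inord_val omegaM => -[->].
by apply/wclassP; exact: (word_eqv_free _ [::] [::] i false).
Qed.

Lemma Delta_mirror i j : Delta (mirror i * mirror j).
Proof.
split=> //; rewrite /Omega_plus /= reverses_orientationM.
by rewrite !reverses_orientation_wclass.
Qed.

(** The half-turns ac, bd, ad generate Delta: an element of Delta is a product
    of pairs of reflections, and ij = (ai)^-1 (aj), where ab = ad bd. *)
Lemma Delta_ind (S : Omega353 -> Prop) : S turn_ac -> S turn_bd -> S turn_ad ->
    (forall x y, Delta x -> Delta y -> S x -> S y -> S (x * y)) ->
    (forall x, Delta x -> S x -> S x^-1) ->
  forall x, Delta x -> S x.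
Proof.
move=> Sp Sq St SM0 SV0.
pose S' x := Delta x /\ S x.
have SM x y : S' x -> S' y -> S' (x * y).
  case=> Dx Sx [Dy Sy]; split; last exact: SM0.
  exact: (subgroupM is_subgroup_Delta).
have SV x : S' x -> S' x^-1.
  case=> Dx Sx; split; last exact: SV0.
  exact: (subgroupV is_subgroup_Delta).
have Sp' : S' turn_ac by split => //; exact: Delta_mirror.
have Sq' : S' turn_bd by split => //; exact: Delta_mirror.
have St' : S' turn_ad by split => //; exact: Delta_mirror.
have S1 : S' 1 by rewrite -turn_ac_sq; exact: SM.
have Sa i : i < 4 -> S' (mirror 0 * mirror i).
  case: i => [|[|[|[|]]]] // _; [by rewrite mirror_sq|].
  by rewrite -turn_ad_bdE; exact: SM.
have Sref i j : i < 4 -> j < 4 -> S' (mirror i * mirror j).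
  move=> i4 j4; have := SM _ _ (SV _ (Sa i i4)) (Sa j j4).
  by rewrite invgM !mirrorV // -!mulgA mirrorK.
have Sword n : forall w, size w <= n -> ~~ odd (size w) ->
    S' ((wclass relators353 w, false) : Omega353).
  elim: n => [|n IH] w; first by case: w.
  case: w => [|l [|m w]] //.
  rewrite /= ltnS negbK => sw ow.
  rewrite -[[:: l, m & w]]/([:: l] ++ [:: m] ++ w).
  rewrite 2!wclassM mulgA -2!omegaM 2!mirror_letter.
  apply: SM; first by apply: Sref; exact: ltn_ord.
  by apply: IH => //; exact: ltnW.
case=> x e [e0 xO]; have {e0} e0 : e = false := e0.
move: e0 xO => ->.
rewrite -[x]wclassK; move: (generic_quotient.repr x) => w.
rewrite /Omega_plus /mkset reverses_orientation_wclass => ow.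
by have [] := Sword _ w (leqnn _) ow.
Qed.

Lemma conjr_Delta x : Delta x -> Delta (conjr x).
Proof.
case: x => x e [e0 xO]; split=> //; move: xO; rewrite /Omega_plus /mkset.
suff -> : reverses_orientation (conjr (x, e)) = reverses_orientation (x, e).
  by [].
rewrite /conjr -[x]wclassK; move: (generic_quotient.repr x) => w.
rewrite [(_, _).1]/(wclass _ _) flip_wclass !reverses_orientation_wclass.
by rewrite size_map.
Qed.

(** * Extending a homomorphism from Delta to Omega^+ *)

Section HalfTurnExtension.
Variables (hT : finGroupType) (f : Omega353 -> hT) (k : hT).

(** Every element of Omega^+ is x or xr with x in Delta; here r is sent to k. *)
Definition half_turn_ext (u : Omega353) : hT := f (u.1, false) * k ^+ u.2.

Hypotheses (fM : morphic_on Delta f) (k2 : k * k = 1).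
Hypotheses (kp : k * f turn_ac = f turn_bd * k).
Hypotheses (kt : k * f turn_ad = f turn_ad * k).

(** The compatibility of f with the two conjugations propagates from the
    generators to Delta.  That of bd follows from that of ac because k is an
    involution. *)
Lemma conjr_conjugation x : Delta x -> f (conjr x) * k = k * f x.
Proof.
have D := is_subgroup_Delta; have fV y := morphic_onV D (x := y) fM.
move: x; apply: Delta_ind.
- by rewrite conjr_ac.
- rewrite conjr_bd; apply: (mulgI k); rewrite !mulgA kp k2 mul1g.
  by rewrite -mulgA k2 mulg1.
- by rewrite conjr_ad.
- move=> x y Dx Dy IHx IHy; have [Dx' Dy'] := (conjr_Delta Dx, conjr_Delta Dy).
  by rewrite conjrM !fM // -mulgA IHy mulgA IHx -mulgA.
- move=> x Dx IH; have Dx' := conjr_Delta Dx.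
  have -> : conjr x^-1 = (conjr x)^-1.
    apply: (mulgI (conjr x)); rewrite mulgV -conjrM mulgV.
    by have := conjrM 1 1; rewrite mul1g -{1}[conjr 1]mulg1 => /mulgI <-.
  rewrite !fV //; apply: (mulgI (f (conjr x))); rewrite mulgA mulgV mul1g.
  by rewrite mulgA IH -mulgA mulgV mulg1.
Qed.

Lemma half_turn_ext_morphic : morphic_on Omega_plus half_turn_ext.
Proof.
move=> [x e] [y f0] Ox Oy; rewrite /half_turn_ext /=.
have Dx : Delta (x, false) by [].
have Dy : Delta (y, false) by [].
case: e {Ox} => /=; last first.
  by rewrite expg0 mulg1 mulgA; congr (_ * _); exact: (fM Dx Dy).
have Dfy : Delta (flip y, false) by exact: (conjr_Delta Dy).
have -> : f (x * flip y, false) = f (x, false) * f (flip y, false).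
  exact: (fM Dx Dfy).
rewrite -!mulgA; congr (_ * _).
have e : f (flip y, false) * k = k * f (y, false) := conjr_conjugation Dy.
case: f0 {Oy} => /=; rewrite ?expg1 ?expg0.
  by rewrite mulgA -e -mulgA k2.
by rewrite e mulg1.
Qed.

(** The kernel does not grow when no element of the coset Delta r becomes
    trivial; the image is that of Delta together with its translate by k. *)
Lemma half_turn_ext_epi (K : set Omega353) (L : {group hT}) :
    (forall x, K x <-> Delta x /\ f x = 1) ->
    (forall x, Delta x -> f x \in L) -> k \in L ->
    (forall y, y \in L ->
       (exists2 x, Delta x & f x = y) \/ (exists2 x, Delta x & f x * k = y)) ->
    (forall x, Delta x -> f x * k <> 1) ->
  epi_with_kernel Omega_plus K half_turn_ext L.
Proof.
move=> Kf fL kL fonto fk; split.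
- exact: half_turn_ext_morphic.
- move=> [x e] Ox; rewrite groupM ?groupX //; exact: fL.
- move=> y /fonto[] [[x e] [/= e0 Ox] <-]; have {e0} -> : e = false := e0.
    by exists (x, false) => //; rewrite /half_turn_ext expg0 mulg1.
  by exists (x, true) => //; rewrite /half_turn_ext expg1.
- move=> [x [|]]; rewrite /half_turn_ext /= ?expg1 ?expg0 ?mulg1.
    split=> [/Kf[[x0 _] _]|[Ox fxk]]; first by have: true = false := x0.
    by have /fk : Delta (x, false) by [].
  by rewrite Kf; split=> [[[_ Ox] fx]|[Ox fx]].
Qed.

End HalfTurnExtension.

(** * Two by two matrices *)

Section TwoByTwo.
Local Open Scope ring_scope.
Variable F : fieldType.
Implicit Types (A B N P Q T : 'M[F]_2).

Lemma sum2 (V : nmodType) (f : 'I_2 -> V) : \sum_i f i = f 0 + f 1.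
Proof.
by rewrite !big_ord_recl big_ord0 addr0; congr (_ + f _); exact: val_inj.
Qed.

Lemma ord2P (i : 'I_2) : i = 0 \/ i = 1.
Proof. by case: i => [[|[|]]] // ?; [left|right]; exact: val_inj. Qed.

Lemma mx2P A B : A 0 0 = B 0 0 -> A 0 1 = B 0 1 -> A 1 0 = B 1 0 ->
  A 1 1 = B 1 1 -> A = B.
Proof.
move=> e00 e01 e10 e11; apply/matrixP=> i j.
by case: (ord2P i) => ->; case: (ord2P j) => ->.
Qed.

Lemma det2 A : \det A = A 0 0 * A 1 1 - A 0 1 * A 1 0.
Proof.
rewrite (expand_det_row _ 0) sum2 /cofactor !det_mx11 !mxE /=.
rewrite !addn0 expr0 mul1r addn1 expr1 mulN1r mulrN.
by congr (_ * A _ _ - _ * A _ _); exact: val_inj.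
Qed.

Lemma tr2 A : \tr A = A 0 0 + A 1 1.
Proof. exact: sum2. Qed.

Lemma mul2E A B i j : (A * B) i j = A i 0 * B 0 j + A i 1 * B 1 j.
Proof. by rewrite mxE sum2. Qed.

(** The Cayley-Hamilton theorem. *)
Lemma mx2_sqr A : A * A = \tr A *: A - (\det A)%:M.
Proof.
by apply: mx2P; rewrite mul2E !mxE tr2 det2 /= ?mulr1n ?mulr0n; ring.
Qed.

(** The polarised form of Cayley-Hamilton for trace 0, where A^2 = - det A: the
    anticommutator is a symmetric bilinear form. *)
Lemma mx2_anticommutator A B : \tr A = 0 -> \tr B = 0 ->
  A * B + B * A = (\tr (A * B))%:M.
Proof.
rewrite !tr2 => /eqP; rewrite addr_eq0 => /eqP A00.
move=> /eqP; rewrite addr_eq0 => /eqP B00.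
by apply: mx2P; rewrite mxE [RHS]mxE /= !mul2E A00 B00 ?mulr1n ?mulr0n; ring.
Qed.

Definition transvection (i j : 'I_2) : 'M[F]_2 := 1 + delta_mx i j.

Lemma det_transvection i j : i != j -> \det (transvection i j) = 1.
Proof.
case: (ord2P i) => ->; case: (ord2P j) => -> //= _;
  by rewrite det2 !mxE /= ?mulr1n ?mulr0n; ring.
Qed.

(** Commutation in the quotient by {1, -1}. *)
Definition commute_up_to_sign A B := A * B = B * A \/ A * B = - (B * A).

(** Commutation gives N j i = 0 at the entry (i, i).  Anticommutation gives
    2 N j i = 0 and N j i = - 2 N i i, so that (N j i)^2 = 0; written in this
    way the argument does not divide by 2. *)
Lemma transvection_signed_commute N i j : i != j ->
  commute_up_to_sign N (transvection i j) -> N j i = 0.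
Proof.
have E A B k l : A = B -> A k l = B k l by move=> ->.
move=> ij C.
have {C} [//| [c_eq a_eq]] : N j i = 0 \/
    N j i = - N j i /\ N i i = - (N i i + N j i).
  have entries : (N * transvection i j) i i = N i i /\
      (N * transvection i j) j i = N j i.
    move: ij; case: (ord2P i) => ->; case: (ord2P j) => -> //= _;
    by rewrite !mul2E !mxE /= ?mulr1n ?mulr0n; split; ring.
  have entries' : (transvection i j * N) i i = N i i + N j i /\
      (transvection i j * N) j i = N j i.
    move: ij {entries C}; case: (ord2P i) => ->; case: (ord2P j) => -> //= _;
    by rewrite !mul2E !mxE /= ?mulr1n ?mulr0n; split; ring.
  have [[e1 e2] [e3 e4]] := (entries, entries').
  case: C => e; rewrite e in e1 e2.
    by left; apply: (addrI (N i i)); rewrite addr0 -e3 e1.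
  have oppE A k l : (- A) k l = - A k l by rewrite mxE.
  by rewrite !oppE e3 e4 in e1 e2; right.
have c_a : N j i = - (N i i + N i i).
  by rewrite {1}a_eq; ring.
apply/eqP; rewrite -[_ == 0]orbb -mulf_eq0 {2}c_a mulrN mulrDr -mulrDl.
by rewrite {2}c_eq subrr mul0r oppr0.
Qed.

(** Off-diagonal entries vanish by commutation, diagonal ones by nilpotency. *)
Lemma nilpotent_signed_commute N :
    (forall i j, i != j -> commute_up_to_sign N (transvection i j)) ->
  N * N = 0 -> N = 0.
Proof.
move=> C NN.
have N10 : N 1 0 = 0 by exact/(transvection_signed_commute _ (C 0 1 _)).
have N01 : N 0 1 = 0 by exact/(transvection_signed_commute _ (C 1 0 _)).
have E A B k l : A = B -> A k l = B k l by move=> ->.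
have := E _ _ 0 0 NN; have := E _ _ 1 1 NN; rewrite !mul2E N10 N01 !mxE.
rewrite !mul0r addr0 add0r => /eqP; rewrite mulf_eq0 orbb => /eqP N11.
move=> /eqP; rewrite mulf_eq0 orbb => /eqP N00.
by apply: mx2P; rewrite mxE.
Qed.

(** The next three lemmas are about N = P - Q, which exchanges P and Q up to
    sign by conjugation, is an involution modulo scalars, and fixes T up to
    sign. *)
Lemma sub_intertwine P Q : P * P = Q * Q -> (P - Q) * P = - (Q * (P - Q)).
Proof. by move=> PQ; rewrite mulrBl mulrBr PQ opprB. Qed.

Lemma sub_sqr P Q : \tr P = 0 -> \tr Q = 0 ->
  (P - Q) * (P - Q) = P * P + Q * Q - (\tr (P * Q))%:M.
Proof.
move=> tP tQ; rewrite -(mx2_anticommutator tP tQ) mulrBl !mulrBr opprB opprD.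
by rewrite addrACA.
Qed.

Lemma sub_anticommute P Q T : \tr P = 0 -> \tr Q = 0 -> \tr T = 0 ->
  \tr (P * T) = \tr (T * Q) -> (P - Q) * T = - (T * (P - Q)).
Proof.
move=> tP tQ tT trE; apply/eqP; rewrite -addr_eq0 mulrBl mulrBr addrACA -opprD.
rewrite mx2_anticommutator // [Q * T + _]addrC mx2_anticommutator // trE.
by rewrite subrr.
Qed.

End TwoByTwo.

(** * Cosets of {1, -1} and of the scalars *)

Section Cosets.
Variable F : finFieldType.
Implicit Types (u v : {'GL_2[F]}) (M : 'M[F]_2).
Local Open Scope ring_scope.

Lemma GL_of_det M : \det M != 0 -> exists u, GLval u = M.
Proof.
move=> dM; have uM : M \is a GRing.unit by rewrite unitmxE unitfE.
by exists (FinRing.Unit uM).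
Qed.

Lemma scalar_GLC u v : is_scalar_mx (GLval u) -> commute u v.
Proof.
case/is_scalar_mxP => a ua; apply: val_inj.
rewrite -[LHS]/(GLval u *m GLval v) -[RHS]/(GLval v *m GLval u) ua.
by rewrite scalar_mxC.
Qed.

Lemma pm1_scalars u : u \in pm1 F -> u \in scalars F.
Proof. by rewrite !finset.inE => /orP[]/eqP->; exact: scalar_mx_is_scalar. Qed.

Lemma norm_scalars u : u \in 'N(scalars F)%g.
Proof.
apply: (fintype.subsetP (cent_sub _)); apply/centP => v.
rewrite finset.inE => v_sc.
exact/commute_sym/scalar_GLC.
Qed.

Lemma norm_pm1 u : u \in 'N(pm1 F)%g.
Proof.
apply: (fintype.subsetP (cent_sub _)); apply/centP => v /pm1_scalars.
rewrite finset.inE => v_sc.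
exact/commute_sym/scalar_GLC.
Qed.

Lemma coset_pm1M u v :
  coset (pm1 F) (u * v)%g = (coset (pm1 F) u * coset (pm1 F) v)%g.
Proof. by rewrite morphM ?norm_pm1. Qed.

Lemma coset_scalarsM u v :
  coset (scalars F) (u * v)%g = (coset (scalars F) u * coset (scalars F) v)%g.
Proof. by rewrite morphM ?norm_scalars. Qed.

Lemma coset_pm1_eq1 u : coset (pm1 F) u = 1%g -> is_scalar_mx (GLval u).
Proof.
by move=> /(coset_idr (norm_pm1 u))/pm1_scalars; rewrite finset.inE.
Qed.

Lemma coset_scalars_eq1 u : coset (scalars F) u = 1%g -> is_scalar_mx (GLval u).
Proof. by move/(coset_idr (norm_scalars u)); rewrite finset.inE. Qed.

Lemma coset_pm1P u v : coset (pm1 F) u = coset (pm1 F) v <->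
  GLval u = GLval v \/ GLval u = - GLval v.
Proof.
split.
  move/(rcoset_kercosetP (norm_pm1 u) (norm_pm1 v))/rcosetP => [w].
  rewrite finset.inE => /orP[]/eqP we ->; rewrite GL_MxE we ?mul1mx.
    by left.
  right.
  by rewrite mul_scalar_mx scaleN1r.
move=> uv; apply/(rcoset_kercosetP (norm_pm1 u) (norm_pm1 v))/rcosetP.
exists (u * v^-1)%g; last by rewrite mulgKV.
rewrite finset.inE GL_MxE GL_VxE; case: uv => ->.
  by rewrite mulmxV ?eqxx // GL_unitmx.
by rewrite mulNmx mulmxV ?GL_unitmx // [(-1)%:M]raddfN eqxx orbT.
Qed.

Lemma coset_scalarsP u v : coset (scalars F) u = coset (scalars F) v <->
  exists a, GLval u = a *: GLval v.
Proof.
split.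
  move/(rcoset_kercosetP (norm_scalars u) (norm_scalars v))/rcosetP => [w].
  rewrite finset.inE => /is_scalar_mxP[a wa] ->; exists a.
  by rewrite GL_MxE wa mul_scalar_mx.
case=> a uv; apply/(rcoset_kercosetP (norm_scalars u) (norm_scalars v))/rcosetP.
exists (u * v^-1)%g; last by rewrite mulgKV.
rewrite finset.inE GL_MxE GL_VxE uv -scalemxAl mulmxV ?GL_unitmx // scalemx1.
exact: scalar_mx_is_scalar.
Qed.

Lemma L2P c : reflect (exists2 u, \det (GLval u) = 1 & c = coset (pm1 F) u)
  (c \in L2 F).
Proof.
apply: (iffP idP).
  by case/morphimP => u _; rewrite finset.inE => /eqP du ->; exists u.
by case=> u du ->; rewrite mem_quotient // inE du eqxx.
Qed.

Lemma scalar_SL2 u : \det (GLval u) = 1 -> is_scalar_mx (GLval u) ->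
  u \in pm1 F.
Proof.
move=> + /is_scalar_mxP[a ua]; rewrite ua det_scalar => /eqP.
rewrite sqrf_eq1 => a1; rewrite finset.inE ua.
by case/orP: a1 => /eqP ->; rewrite eqxx ?orbT.
Qed.

(** By Cayley-Hamilton, u^2 = (tr u) u - 1; if u^2 is scalar and tr u is not 0,
    then u itself is scalar, hence trivial in L_2(q). *)
Lemma involution_trace0 u : \det (GLval u) = 1 -> coset (pm1 F) u != 1%g ->
  (coset (pm1 F) u * coset (pm1 F) u)%g = 1%g -> \tr (GLval u) = 0.
Proof.
move=> du cu; rewrite -coset_pm1M => /coset_pm1_eq1/is_scalar_mxP[a].
rewrite GL_ME => eqa; have := mx2_sqr (GLval u); rewrite eqa du => e.
apply: contraNeq cu => tr0; apply/eqP/coset_id/scalar_SL2 => //.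
have -> : GLval u = ((\tr (GLval u))^-1 * (a + 1))%:M.
  rewrite -scale_scalar_mx raddfD /= e subrK scalerA mulVf // scale1r //.
exact: scalar_mx_is_scalar.
Qed.

(** By Cayley-Hamilton, u^3 = (s^2 - 1) u - s with s = tr u; if u^3 is scalar
    and s^2 is not 1, then u itself is scalar, hence trivial in L_2(q). *)
Lemma order3_trace u : \det (GLval u) = 1 -> coset (pm1 F) u != 1%g ->
  (coset (pm1 F) u ^+ 3)%g = 1%g -> \tr (GLval u) = 1 \/ \tr (GLval u) = -1.
Proof.
move=> du cu; have -> : (coset (pm1 F) u ^+ 3)%g = coset (pm1 F) (u ^+ 3)%g.
  by rewrite !expgS !expg0 !mulg1 !coset_pm1M.
move=> /coset_pm1_eq1/is_scalar_mxP[a].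
set s := \tr _; rewrite expgS expg2 !GL_ME mx2_sqr du mulrBr -scalerAr mulr1.
rewrite mx2_sqr du -/s => e.
suff : s ^+ 2 == 1 by rewrite sqrf_eq1 => /orP[]/eqP; [left | right].
apply: contraNT cu => s1.
apply/eqP/coset_id/scalar_SL2 => //.
have s1' : s ^+ 2 - 1 != 0 by rewrite subr_eq0.
have -> : GLval u = ((s ^+ 2 - 1)^-1 * (a + s))%:M.
  rewrite -scale_scalar_mx raddfD /= -e scalerBr scalerA -expr2.
  rewrite scalemx1 addrAC subrK -{3}[GLval u]scale1r -scalerBl scalerA.
  by rewrite mulVf // scale1r.
exact: scalar_mx_is_scalar.
Qed.

Lemma commute_up_to_signN (N A : 'M[F]_2) :
  commute_up_to_sign N (- A) -> commute_up_to_sign N A.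
Proof.
by rewrite /commute_up_to_sign mulrN mulNr => -[/oppr_inj|/oppr_inj];
  [left|right].
Qed.

(** Commuting with N up to sign is a property of cosets of {1, -1} that is
    closed under products; it passes from generators to all of L_2(q). *)
Lemma signed_centralizer_group_set (N : 'M[F]_2) :
  group_set [set c : coset_of (pm1 F) |
    `[< exists2 u, c = coset (pm1 F) u & commute_up_to_sign N (GLval u) >]].
Proof.
apply/group_setP; split=> [|c d].
  rewrite finset.inE; apply/asboolP; exists 1%g; first by rewrite morph1.
  by left; rewrite GL_1E mulr1 mul1r.
rewrite !finset.inE => /asboolP[u -> Cu] /asboolP[v -> Cv]; apply/asboolP.
exists (u * v)%g; first by rewrite coset_pm1M.
rewrite /commute_up_to_sign GL_ME mulrA.
case: Cu Cv => -> [] Cv; rewrite ?mulNr -!mulrA Cv ?mulrN ?opprK;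
  by [left|right].
Qed.

Lemma transvection_cosets (S : {group coset_of (pm1 F)}) : L2 F \subset S ->
  forall i j, i != j ->
    exists2 u, coset (pm1 F) u \in S & GLval u = transvection F i j.
Proof.
move=> sLS i j ij; have d1 := det_transvection F ij.
have [|u uE] := @GL_of_det (transvection F i j); first by rewrite d1 oner_eq0.
exists u => //; apply: (fintype.subsetP sLS); apply/L2P.
by exists u; rewrite ?uE.
Qed.

Lemma L2_sub_signed_centralizer (N : 'M[F]_2) :
  L2 F \subset Group (signed_centralizer_group_set N) -> N * N = 0 -> N = 0.
Proof.
move=> sLS NN; apply: nilpotent_signed_commute => // i j ij.
have [u + <-] := transvection_cosets sLS ij.
rewrite finset.inE => /asboolP[v /coset_pm1P uv Cv]; case: uv => -> //.
by apply: commute_up_to_signN; rewrite opprK.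
Qed.

Lemma L2_nontrivial : ~ (L2 F \subset [1 coset_of (pm1 F)]%G).
Proof.
move=> /transvection_cosets/(_ 0 1 isT)[u + uE].
rewrite finset.inE => /eqP; rewrite -(morph1 (coset (pm1 F))) => /coset_pm1P.
have -> : GLval (1%g : {'GL_2[F]}) = (1%:M : 'M[F]_2) by [].
rewrite uE => -[] /(congr1 (fun A : 'M[F]_2 => A 0 1));
  rewrite !mxE /= add0r ?oppr0 => /eqP;
  by rewrite oner_eq0.
Qed.

End Cosets.

(** * Relations among the three involutions *)

(** The consequences of the relations of Delta in a nontrivial image: none of
    the elements whose order matters collapses, since a collapse would make one
    of p, q, t an element of odd order with trivial square, hence trivial. *)
Section Involutions.
Variables (gT : finGroupType) (p q t : gT).
Hypotheses (p2 : p * p = 1) (q2 : q * q = 1) (t2 : t * t = 1).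
Hypotheses (tq3 : (t * q) ^+ 3 = 1) (pt3 : (p * t) ^+ 3 = 1).
Hypothesis qtp5 : (q * t * p) ^+ 5 = 1.
Hypothesis nontrivial : ~ [/\ p = 1, q = 1 & t = 1].

Lemma involution_odd (x : gT) n : x * x = 1 -> odd n -> x ^+ n = 1 -> x = 1.
Proof.
move=> x2 on; rewrite -[n]odd_double_half on -mul2n expgD expgM expg2 x2.
by rewrite expg1n mulg1.
Qed.

Lemma t_neq1 : t != 1.
Proof.
apply/eqP => t1; apply: nontrivial; split=> //.
  by apply: (@involution_odd _ 3) => //; rewrite -pt3 t1 mulg1.
by apply: (@involution_odd _ 3) => //; rewrite -tq3 t1 mul1g.
Qed.

Lemma p_neq1 : p != 1.
Proof.
apply: contraNneq t_neq1 => p1; apply/eqP/(@involution_odd _ 3) => //.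
by rewrite -pt3 p1 mul1g.
Qed.

Lemma q_neq1 : q != 1.
Proof.
apply: contraNneq t_neq1 => q1; apply/eqP/(@involution_odd _ 3) => //.
by rewrite -tq3 q1 mulg1.
Qed.

(** If p = q, then qtp is conjugate to t. *)
Lemma p_neqq : p != q.
Proof.
apply: contraNneq t_neq1 => pq; apply/eqP/(@involution_odd _ 5) => //.
have qV : q^-1 = q by apply: (mulgI q); rewrite mulgV q2.
have := qtp5; rewrite pq -{1}qV -[_ * t * q]mulgA -/(conjg t q) -conjXg.
by move=> /(canRL (conjgK _)) ->; rewrite conj1g.
Qed.

Lemma tq_neq1 : t * q != 1.
Proof.
apply: contraNneq p_neq1 => tq; apply/eqP/(@involution_odd _ 5) => //.
have tE : t = q by apply: (mulIg q); rewrite tq q2.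
by rewrite -[RHS]qtp5 tE q2 mul1g.
Qed.

Lemma pt_neq1 : p * t != 1.
Proof.
apply: contraNneq q_neq1 => pt; apply/eqP/(@involution_odd _ 5) => //.
have pE : p = t by apply: (mulIg t); rewrite pt t2.
by rewrite -[RHS]qtp5 pE -mulgA t2 mulg1.
Qed.

End Involutions.

(** * The conjugating matrix *)

(** Generation is used twice: it makes p, q, t nontrivial, and it forces the
    singular case to degenerate. *)
Lemma exists_intertwiner (F : finFieldType) (p q t : coset_of (pm1 F)) :
    p \in L2 F -> q \in L2 F -> t \in L2 F ->
    p * p = 1 -> q * q = 1 -> t * t = 1 ->
    (t * q) ^+ 3 = 1 -> (p * t) ^+ 3 = 1 -> (q * t * p) ^+ 5 = 1 ->
    (forall S : {group coset_of (pm1 F)},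
      p \in S -> q \in S -> t \in S -> L2 F \subset S) ->
  exists g : {'GL_2[F]}, [/\ is_scalar_mx (GLval (g * g)),
    coset (pm1 F) g * p = q * coset (pm1 F) g &
    coset (pm1 F) g * t = t * coset (pm1 F) g].
Proof.
move=> pL qL tL p2 q2 t2 tq3 pt3 qtp5 gen.
have nontriv : ~ [/\ p = 1, q = 1 & t = 1].
  case=> p1 q1 t1; apply: (@L2_nontrivial F); apply: gen.
  - by rewrite finset.inE p1.
  - by rewrite finset.inE q1.
  - by rewrite finset.inE t1.
have p1 := p_neq1 p2 q2 t2 tq3 pt3 nontriv.
have q1 := q_neq1 p2 q2 t2 tq3 pt3 nontriv.
have t1 := t_neq1 p2 q2 tq3 pt3 nontriv.
have pq := p_neqq p2 q2 t2 tq3 pt3 qtp5 nontriv.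
have tq1 := tq_neq1 p2 q2 t2 tq3 pt3 qtp5 nontriv.
have pt1 := pt_neq1 p2 q2 t2 tq3 pt3 qtp5 nontriv.
case/L2P: tL => T dT tE; case/L2P: qL => Q dQ qE; case/L2P: pL => P0 dP0 pE0.
(* The sign of the lift of p is chosen so that both products of order 3 have the
   same trace. *)
have [P [dP pE trPT]] : exists P : {'GL_2[F]}, [/\ (\det (GLval P) = 1)%R,
    p = coset (pm1 F) P &
    (\tr (GLval P * GLval T) = \tr (GLval T * GLval Q))%R].
  have dPT : (\det (GLval (P0 * T)) = 1)%R.
    by rewrite GL_MxE det_mulmx dP0 dT mulr1.
  have dTQ : (\det (GLval (T * Q)) = 1)%R.
    by rewrite GL_MxE det_mulmx dT dQ mulr1.
  have PTE : p * t = coset (pm1 F) (P0 * T) by rewrite pE0 tE coset_pm1M.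
  have TQE : t * q = coset (pm1 F) (T * Q) by rewrite qE tE coset_pm1M.
  rewrite PTE in pt1 pt3; rewrite TQE in tq1 tq3.
  have trPT := order3_trace dPT pt1 pt3; have trTQ := order3_trace dTQ tq1 tq3.
  have [e|ne] := eqVneq (\tr (GLval (P0 * T)))%R (\tr (GLval (T * Q)))%R.
    by exists P0.
  have dP0N : (\det (- GLval P0) = 1)%R.
    by rewrite -scaleN1r detZ dP0 mulr1 sqrrN expr1n.
  have [|P PE] := @GL_of_det _ (- GLval P0)%R; first by rewrite dP0N oner_eq0.
  exists P; rewrite PE; split=> //.
    by rewrite pE0; apply/coset_pm1P; right; rewrite PE opprK.
  have trN (A : 'M[F]_2) : (\tr (- A) = - \tr A)%R by rewrite raddfN.
  rewrite mulNr trN -!GL_ME; move: ne.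
  by case: trPT trTQ => -> [] ->; rewrite ?eqxx ?opprK.
have trP : (\tr (GLval P) = 0)%R by apply: involution_trace0; rewrite -?pE.
have trQ : (\tr (GLval Q) = 0)%R by apply: involution_trace0; rewrite -?qE.
have trT : (\tr (GLval T) = 0)%R by apply: involution_trace0; rewrite -?tE.
have P2 : (GLval P * GLval P = - 1%:M)%R.
  by rewrite mx2_sqr trP dP scale0r add0r.
have Q2 : (GLval Q * GLval Q = - 1%:M)%R.
  by rewrite mx2_sqr trQ dQ scale0r add0r.
pose N := (GLval P - GLval Q)%R.
have NP : (N * GLval P = - (GLval Q * N))%R.
  by apply: sub_intertwine; rewrite P2.
have NT : (N * GLval T = - (GLval T * N))%R by exact: sub_anticommute.
have NN := sub_sqr trP trQ; rewrite P2 Q2 -/N in NN.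
have [dN|dN] := eqVneq (\det N)%R 0%R; last first.
  have [g gE] := GL_of_det dN; exists g; split.
  - rewrite GL_ME gE NN -!raddfN -!raddfD /=; exact: scalar_mx_is_scalar.
  - rewrite pE qE -!coset_pm1M; apply/coset_pm1P; right.
    by rewrite !GL_ME gE.
  - rewrite tE -!coset_pm1M; apply/coset_pm1P; right.
    by rewrite !GL_ME gE.
(* The singular case: N is nilpotent, and by the generation hypothesis it
   commutes up to sign with everything. *)
have N2 : (N * N = 0)%R.
  have trN : (\tr N = \tr (GLval P) - \tr (GLval Q))%R by exact: raddfB.
  by rewrite mx2_sqr dN raddf0 subr0 trN trP trQ subr0 scale0r.
have PN : (GLval P * N = GLval Q * N)%R.
  by apply/eqP; rewrite -subr_eq0 -mulrBl -/N N2.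
have NPQ : (N * GLval P = N * GLval Q)%R.
  by apply/eqP; rewrite -subr_eq0 -mulrBr -/N N2.
have N0 : N = 0%R.
  apply: L2_sub_signed_centralizer N2; apply: gen;
    rewrite finset.inE; apply/asboolP.
  - by exists P => //; right; rewrite NP PN.
  - by exists Q => //; right; rewrite -NPQ NP.
  - by exists T => //; right.
case/eqP: pq; rewrite pE qE; apply/coset_pm1P; left.
by apply/eqP; rewrite -subr_eq0 -/N N0.
Qed.

(** * The two possible quotients of Omega^+ *)

(** The multiplicative group is cyclic, and nonsquares are the odd powers of a
    generator. *)
Lemma nonsquare_div (F : finFieldType) (a b : F) : a != 0%R -> b != 0%R ->
    ~ (exists c, a = c ^+ 2)%R -> ~ (exists c, b = c ^+ 2)%R ->
  (exists c, a / b = c ^+ 2)%R.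
Proof.
move=> a0 b0 a_nsq b_nsq.
have /cyclicP[z zE] := field_unit_group_cyclic [set: {unit F}]%G.
have log (x : F) : x != 0%R -> exists n, x = (FinRing.uval z ^+ n)%R.
  move=> x0; have ux : x \is a GRing.unit by rewrite unitfE.
  have : FinRing.Unit ux \in <[z]> by rewrite -zE finset.inE.
  case/cycleP => n /(congr1 (@FinRing.uval F)).
  rewrite FinRing.val_unitX /= => e.
  by exists n.
have odd_log (x : F) : x != 0%R -> ~ (exists c, x = c ^+ 2)%R ->
    exists n, x = (FinRing.uval z ^+ n.*2.+1)%R.
  move=> x0 x_nsq; have [n xE] := log x x0.
  have nE := odd_double_half n; case on : (odd n) nE => nE.
    by exists n./2; rewrite xE -[in LHS]nE.
  by case: x_nsq; exists (FinRing.uval z ^+ n./2)%R;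
    rewrite -exprM muln2 xE -[in LHS]nE.
have [m ->] := odd_log a a0 a_nsq; have [n bE] := odd_log b b0 b_nsq.
have z0 : FinRing.uval z != 0%R.
  by apply: contraNneq b0 => z0; rewrite bE z0 expr0n.
exists (FinRing.uval z ^+ m / FinRing.uval z ^+ n)%R; rewrite bE.
rewrite ![(_ ^+ _.*2.+1)%R]exprS -!muln2 !exprM expr_div_n -mulf_div.
by rewrite divff // mul1r.
Qed.

Section Target.
Variable F : finFieldType.

(** The embedding of L_2(q) in PGL_2(q); it does not depend on the
    representative because -1 is scalar. *)
Definition L2_in_PGL2 (c : coset_of (pm1 F)) : coset_of (scalars F) :=
  coset (scalars F) (repr c).

Lemma L2_in_PGL2E (u : {'GL_2[F]}) :
  L2_in_PGL2 (coset (pm1 F) u) = coset (scalars F) u.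
Proof.
apply/coset_scalarsP; have /coset_pm1P[->|->] := coset_reprK (coset (pm1 F) u).
  by exists 1%R; rewrite scale1r.
by exists (-1)%R; rewrite scaleN1r.
Qed.

Lemma coset_pm1_surj (c : coset_of (pm1 F)) : exists u, c = coset (pm1 F) u.
Proof. by exists (repr c); rewrite coset_reprK. Qed.

Lemma L2_in_PGL2M : {morph L2_in_PGL2 : c d / c * d}.
Proof.
move=> c d; have [[u ->] [v ->]] := (coset_pm1_surj c, coset_pm1_surj d).
by rewrite -coset_pm1M !L2_in_PGL2E coset_scalarsM.
Qed.

Lemma scalar_coset_central (s : {'GL_2[F]}) (c : coset_of (pm1 F)) :
  is_scalar_mx (GLval s) -> coset (pm1 F) s * c = c * coset (pm1 F) s.
Proof.
move=> ss; have [u ->] := coset_pm1_surj c.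
by rewrite -!coset_pm1M scalar_GLC.
Qed.

(** Divide by a square root of the determinant. *)
Lemma exists_SL2_multiple (u : {'GL_2[F]}) :
    (exists c, \det (GLval u) = c ^+ 2)%R ->
  exists s, is_scalar_mx (GLval s) /\ (\det (GLval (s * u)) = 1)%R.
Proof.
case=> c dE; have c0 : (c != 0)%R.
  by apply: contra_eqN dE => /eqP->; rewrite expr0n; exact: GL_det.
have [|s sE] := @GL_of_det F (c^-1)%:M%R.
  by rewrite det_scalar expf_neq0 // invr_neq0.
exists s; split; first by rewrite sE scalar_mx_is_scalar.
by rewrite GL_MxE det_mulmx sE det_scalar dE -exprMn mulVf // expr1n.
Qed.

Section Quotient.
Variables (K : set Omega353) (f : Omega353 -> coset_of (pm1 F)).
Hypothesis f_epi : epi_with_kernel Delta K f (L2 F).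
Variable g : {'GL_2[F]}.
Hypothesis g_sq : is_scalar_mx (GLval (g * g)).
Hypothesis gp : coset (pm1 F) g * f turn_ac = f turn_bd * coset (pm1 F) g.
Hypothesis gt : coset (pm1 F) g * f turn_ad = f turn_ad * coset (pm1 F) g.

(** The intertwiner may be taken in SL_2(q), so that r acts on L_2(q) as an
    inner automorphism; the factor C_2 records the coset of Delta. *)
Lemma epi_L2xC2_of_square : (exists c, \det (GLval g) = c ^+ 2)%R ->
  exists h, epi_with_kernel Omega_plus K h (L2xC2 F).
Proof.
case: f_epi => fM fL fonto Kf /exists_SL2_multiple[s [s_sc dsg]].
pose k : coset_of (pm1 F) * 'Z_2 := (coset (pm1 F) (s * g), 1%R).
pose f2 x : coset_of (pm1 F) * 'Z_2 := (f x, 1).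
have sgE c d : coset (pm1 F) g * c = d * coset (pm1 F) g ->
    coset (pm1 F) (s * g) * c = d * coset (pm1 F) (s * g).
  move=> cd; rewrite coset_pm1M -mulgA cd !mulgA; congr (_ * _).
  exact: scalar_coset_central.
have kL : coset (pm1 F) (s * g) \in L2 F by apply/L2P; exists (s * g).
exists (half_turn_ext f2 k); apply: half_turn_ext_epi.
- by move=> x y Dx Dy; rewrite /f2 fM //; congr (_, _); rewrite mulg1.
- suff kk : coset (pm1 F) (s * g) * coset (pm1 F) (s * g) = 1.
    by congr (_, _); [exact: kk | exact: val_inj].
  rewrite -coset_pm1M; apply/coset_id/scalar_SL2.
    by rewrite GL_MxE det_mulmx dsg mulr1.
  have [a sa] := is_scalar_mxP s_sc; have [b gb] := is_scalar_mxP g_sq.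
  have -> : s * g * (s * g) = s * s * (g * g).
    rewrite !mulgA; congr (_ * _); rewrite -!mulgA; congr (_ * _).
    exact/commute_sym/scalar_GLC.
  rewrite GL_MxE [GLval (s * s)]GL_MxE sa gb -!scalar_mxM.
  exact: scalar_mx_is_scalar.
- by congr (_, _); [exact: (sgE _ _ gp) | exact: val_inj].
- by congr (_, _); [exact: (sgE _ _ gt) | exact: val_inj].
- move=> x; rewrite Kf; split=> -[Dx fx]; split=> //; last by case: fx.
  by rewrite /f2 fx.
- by move=> x Dx; rewrite finset.in_setX fL // finset.inE.
- by rewrite finset.in_setX kL finset.inE.
- move=> [y e]; rewrite finset.in_setX => /andP[yL _].
  have [e1|e1] := eqVneq e 1%R; [right|left].
    have [|x Dx fx] := fonto (y * (coset (pm1 F) (s * g))^-1).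
      by rewrite groupM ?groupV.
    exists x => //; rewrite /f2 fx e1.
    by congr (_, _); rewrite /= ?mulgKV ?mul1g.
  have [x Dx fx] := fonto y yL; exists x => //; rewrite /f2 fx; congr (_, _).
  by apply: val_inj; case: e e1 => [[|[|]]].
- by move=> x Dx [_].
Qed.

(** A matrix is a scalar multiple of an element of SL_2(q) exactly when its
    determinant is a square; so the class of g lies outside L_2(q), and with
    L_2(q) it generates PGL_2(q). *)
Lemma epi_PGL2_of_nonsquare : ~ (exists c, \det (GLval g) = c ^+ 2)%R ->
  exists h, epi_with_kernel Omega_plus K h (PGL2 F).
Proof.
case: f_epi => fM fL fonto Kf g_nsq; pose k := coset (scalars F) g.
pose f2 x := L2_in_PGL2 (f x).
have gE c d : coset (pm1 F) g * c = d * coset (pm1 F) g ->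
    k * L2_in_PGL2 c = L2_in_PGL2 d * k.
  by move=> cd; rewrite /k -L2_in_PGL2E -!L2_in_PGL2M cd.
have fP x : Delta x ->
    exists2 u, (\det (GLval u) = 1)%R & f x = coset (pm1 F) u.
  by move=> /fL/L2P.
have inPGL (u : {'GL_2[F]}) : coset (scalars F) u \in PGL2 F.
  by rewrite mem_quotient // finset.inE.
have onto_sq (u : {'GL_2[F]}) : (exists c, \det (GLval u) = c ^+ 2)%R ->
    exists2 x, Delta x & f2 x = coset (scalars F) u.
  move=> /exists_SL2_multiple[s [s_sc dsu]].
  have [|x Dx fx] := fonto (coset (pm1 F) (s * u)).
    by apply/L2P; exists (s * u).
  exists x => //; rewrite /f2 fx L2_in_PGL2E coset_scalarsM.
  by rewrite [coset _ s]coset_id ?mul1g // finset.inE.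
exists (half_turn_ext f2 k); apply: half_turn_ext_epi.
- by move=> x y Dx Dy; rewrite /f2 fM // L2_in_PGL2M.
- by rewrite /k -coset_scalarsM; apply: coset_id; rewrite finset.inE.
- exact: gE.
- exact: gE.
- move=> x; rewrite Kf; split=> -[Dx fx]; split=> //.
    by rewrite /f2 fx -(morph1 (coset (pm1 F))) L2_in_PGL2E morph1.
  move: fx; rewrite /f2; have [u du ->] := fP x Dx.
  by rewrite L2_in_PGL2E => /coset_scalars_eq1/(scalar_SL2 du)/coset_id.
- by move=> x Dx; exact: inPGL.
- exact: inPGL.
- move=> y _; have [u ->] : exists u, y = coset (scalars F) u.
    by exists (repr y); rewrite coset_reprK.
  have [u_sq|u_nsq] := pselect (exists c, \det (GLval u) = c ^+ 2)%R.
    by left; exact: onto_sq.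
  right; have [|x Dx fx] := onto_sq (u * g^-1).
    rewrite GL_MxE GL_VxE det_mulmx det_inv.
    by apply: nonsquare_div => //; exact: GL_det.
  by exists x => //; rewrite fx -coset_scalarsM mulgKV.
- move=> x Dx; rewrite /f2; have [u du ->] := fP x Dx.
  rewrite L2_in_PGL2E /k -coset_scalarsM.
  move=> /coset_scalars_eq1/is_scalar_mxP[a uga].
  apply: g_nsq; exists a; rewrite -det_scalar -uga GL_MxE det_mulmx du.
  by rewrite mul1r.
Qed.

End Quotient.
End Target.

Theorem theorem1p2 (F : finFieldType) (q_ge4 : 4 <= #|F|)
    (K : set Omega353) (K_normal : normal_in K Delta)
    (K_quotient : quotient_iso Delta K (L2 F)) :
  normal_in K Omega_plus /\
  (quotient_iso Omega_plus K (PGL2 F) \/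
   quotient_iso Omega_plus K (L2xC2 F)).
Proof.
have sgD := is_subgroup_Delta; have sgO := is_subgroup_Omega_plus.
have [f f_epi] := quotient_iso_epi sgD K_normal K_quotient.
have [fM fL fonto _] := f_epi.
have fX x n : Delta x -> f (x ^+ n) = f x ^+ n.
  move=> Dx; suff [] : Delta (x ^+ n) /\ f (x ^+ n) = f x ^+ n by [].
  elim: n => [|n [Dn IH]].
    by split; [exact: subgroup1|exact: (morphic_on1 sgD)].
  by rewrite !expgS fM // IH; split=> //; exact: (subgroupM sgD).
have f1 : f 1 = 1 := morphic_on1 sgD fM.
have DM := subgroupM sgD.
have [Dp Dq Dt] : [/\ Delta turn_ac, Delta turn_bd & Delta turn_ad].
  by split; exact: Delta_mirror.
have [||||||||||g [g_sq gp gt]] :=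
  @exists_intertwiner F (f turn_ac) (f turn_bd) (f turn_ad).
- exact: fL.
- exact: fL.
- exact: fL.
- by rewrite -fM // turn_ac_sq.
- by rewrite -fM // turn_bd_sq.
- by rewrite -fM // turn_ad_sq.
- by rewrite -fM // -fX ?turn_ad_bd_cube //; exact: DM.
- by rewrite -fM // -fX ?turn_ac_ad_cube //; exact: DM.
- have Dqt := DM _ _ Dq Dt.
  by rewrite -!fM // -fX ?turn_bd_ad_ac_pow5 //; exact: DM.
- move=> S pS qS tS; apply/fintype.subsetP => _ /fonto[x Dx <-].
  move: x Dx; apply: Delta_ind => // [x y Dx Dy xS yS|x Dx xS].
    by rewrite fM // groupM.
  by rewrite (morphic_onV sgD) // groupV.
have [g_det|g_det] := pselect (exists c, \det (GLval g) = c ^+ 2)%R.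
  have [h /(epi_quotient_iso sgO)[]] :=
    epi_L2xC2_of_square f_epi g_sq gp gt g_det.
  by split; last right.
have [h /(epi_quotient_iso sgO)[]] :=
  epi_PGL2_of_nonsquare f_epi g_sq gp gt g_det.
by split; last left.
Qed.
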